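(* Let $\phi:\mathbb{R}^n\to\overline{\mathbb{R}}$ be a reference function and let $f\in\mathcal{C}^1(\mathbb{R}^n)$ be anisotropically smooth relative to $\phi$ with constant $L>0$ and satisfy $f_\star=\inf f>-\infty$. Let $\beta\in[0,0.5)$ and $\gamma=\frac{\alpha}{L}$ with $0<\alpha\le 1$, let $x^0\in\mathbb{R}^n$, $m^{-1}=0$, and let $\{x^k\}_{k\in\mathbb{N}_0}$ be generated for $k=0,1,\dots$ by $$m^k=\beta m^{k-1}+(1-\beta)\nabla\phi^*(\nabla f(x^k)),\qquad x^{k+1}=x^k-\gamma m^k .$$ Then, for every $K\in\mathbb{N}_0$, $$\min_{0\le k\le K}\phi(\nabla\phi^*(\nabla f(x^k)))\le\frac{L(f(x^0)-f_\star)}{\alpha(K+1)(1-2\beta)}.$$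
   Context: $\overline{\mathbb{R}}=\mathbb{R}\cup\{+\infty\}$; $\|\cdot\|$ is the Euclidean norm on $\mathbb{R}^n$; $\phi^*$ is the convex conjugate of $\phi$. Reference function: $\phi:\mathbb{R}^n\to\overline{\mathbb{R}}$ is strongly convex and even with $\phi(0)=0$; $\operatorname{int}\operatorname{dom}\phi\neq\emptyset$; $\phi\in\mathcal{C}^2(\operatorname{int}\operatorname{dom}\phi)$; and for any sequence $\{x^k\}$ (in $\operatorname{int}\operatorname{dom}\phi$, where $\nabla\phi$ is defined) that converges to some boundary point of $\operatorname{int}\operatorname{dom}\phi$, $\|\nabla\phi(x^k)\|\to+\infty$. (Under these conditions $\phi^*\in\mathcal{C}^2(\mathbb{R}^n)$ and the range of $\nabla\phi$ is all of $\mathbb{R}^n$.) Episcaling: for $\lambda>0$, $(\lambda\star\phi)(x)=\lambda\phi(\lambda^{-1}x)$. Anisotropic smoothness: $f\in\mathcal{C}^1(\mathbb{R}^n)$ is anisotropically smooth relative to $\phi$ with constant $L>0$ if for all $x,\bar x\in\mathbb{R}^n$ $$f(x)\le f(\bar x)+\left(\tfrac1L\star\phi\right)(x-\bar y)-\left(\tfrac1L\star\phi\right)(\bar x-\bar y),\qquad \bar y=\bar x-\tfrac1L\nabla\phi^*(\nabla f(\bar x)).$$ (The right-hand side may be $+\infty$.) *)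

(* Defs.v *)
From HB Require Import structures.
From mathcomp Require Export all_boot all_order all_algebra.
From mathcomp Require Export all_classical all_reals all_analysis.
Export Order.TTheory GRing.Theory Num.Theory.
Export numFieldNormedType.Exports.

Set Implicit Arguments.
Unset Strict Implicit.
Unset Printing Implicit Defensive.

Local Open Scope classical_set_scope.
Local Open Scope ring_scope.

(* The library norm on ['rV[R]_n] is the sup norm, hence [enorm]; the topology
   is the same. *)
Definition dot (R : realType) (n : nat) (u v : 'rV[R]_n) : R :=
  \sum_(i < n) u 0 i * v 0 i.

Definition enorm (R : realType) (n : nat) (u : 'rV[R]_n) : R :=
  Num.sqrt (dot u u).

Definition grad (R : realType) (n : nat) (g : 'rV[R]_n -> R) (x : 'rV[R]_n) :
    'rV[R]_n :=
  \row_(i < n) 'D_(delta_mx 0 i) g x.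

Definition C1 (R : realType) (n : nat) (g : 'rV[R]_n -> R) : Prop :=
  (forall x, differentiable g x) /\ continuous (grad g).

(* For an open set [U]; ['J (grad g) x] is the Hessian, and continuity of [g]
   and [grad g] on [U] follows from differentiability. *)
Definition C2_on (R : realType) (n : nat) (U : set 'rV[R]_n)
    (g : 'rV[R]_n -> R) : Prop :=
  forall x, U x ->
    [/\ differentiable g x, differentiable (grad g) x &
        {for x, continuous (fun z => 'J (grad g) z)}].

Definition dom (R : realType) (n : nat) (phi : 'rV[R]_n -> \bar R) :
    set 'rV[R]_n :=
  [set x | (phi x < +oo)%E].

Definition strongly_convex (R : realType) (n : nat)
    (phi : 'rV[R]_n -> \bar R) : Prop :=
  exists2 mu : R, 0 < mu &
    forall (x y : 'rV[R]_n) (t : R), 0 < t < 1 ->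
      (phi (t *: x + (1 - t) *: y)%R <=
       t%:E * phi x + (1 - t)%:E * phi y
       - (mu / 2 * t * (1 - t) * enorm (x - y) ^+ 2)%R%:E)%E.

Definition conjugate (R : realType) (n : nat) (phi : 'rV[R]_n -> \bar R)
    (y : 'rV[R]_n) : \bar R :=
  ereal_sup [set ((dot x y)%:E - phi x)%E | x in [set: 'rV[R]_n]].

(* Gradient of an extended-real-valued function, meaningful at points near
   which the function is finite and differentiable. *)
Definition egrad (R : realType) (n : nat) (g : 'rV[R]_n -> \bar R) :
    'rV[R]_n -> 'rV[R]_n :=
  grad (fine \o g).

Record reference_function (R : realType) (n : nat)
    (phi : 'rV[R]_n -> \bar R) : Prop := ReferenceFunction {
  ref_proper : forall x, phi x != -oo%E ;
  ref_strongly_convex : strongly_convex phi ;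
  ref_even : forall x, phi (- x) = phi x ;
  ref0 : phi 0 = 0%E ;
  ref_int_dom : interior (dom phi) !=set0 ;
  ref_C2 : C2_on (interior (dom phi)) (fine \o phi) ;
  ref_blowup : forall (u : nat -> 'rV[R]_n) (z : 'rV[R]_n),
    (forall k, interior (dom phi) (u k)) ->
    (closure (interior (dom phi)) `\` interior (dom phi)) z ->
    u @ \oo --> z ->
    (fun k => enorm (egrad phi (u k))) @ \oo --> +oo
}.

Definition episcale (R : realType) (n : nat) (lambda : R)
    (phi : 'rV[R]_n -> \bar R) (x : 'rV[R]_n) : \bar R :=
  (lambda%:E * phi (lambda^-1 *: x)%R)%E.

(* The subtracted term equals [L^-1 * phi (egrad (conjugate phi) (grad f xb))],
   which is finite for a reference function since the gradient of the conjugate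
   takes its values in the interior of the domain; so no [+oo - +oo] arises. *)
Definition anisotropically_smooth (R : realType) (n : nat)
    (phi : 'rV[R]_n -> \bar R) (L : R) (f : 'rV[R]_n -> R) : Prop :=
  forall x xb : 'rV[R]_n,
    let yb := xb - L^-1 *: egrad (conjugate phi) (grad f xb) in
    ((f x)%:E <= (f xb)%:E + episcale L^-1 phi (x - yb)%R
                 - episcale L^-1 phi (xb - yb)%R)%E.

(* Main.v *)
Require Import Defs.
From mathcomp Require Import all_boot all_order all_algebra.
From mathcomp Require Import all_classical all_reals all_analysis.
From mathcomp Require Import ring lra.

(** Write [g k] for the preconditioned gradient at [x k]. Anisotropic smoothness
    at [x k], tested at [x k.+1], gives
    [f (x k.+1) - f (x k) <= (phi (g k - alpha * m k) - phi (g k)) / L].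
    Since [g k - alpha * m k] equals
    [(1 - alpha) * g k + alpha * beta * (g k - m (k - 1))], convexity, evenness
    and [phi 0 = 0] bound [phi (g k - alpha * m k)] by
    [(1 - alpha) * phi (g k) + alpha * beta * (phi (g k) + phi (m (k - 1)))].
    The terms in [phi (m (k - 1))] are absorbed by the Lyapunov function
    [f (x k) + gamma * beta / (1 - beta) * phi (m (k - 1))], which therefore
    decreases by at least [gamma * (1 - 2 * beta) * phi (g k)] at every step. *)

Set Implicit Arguments.
Unset Strict Implicit.

Local Open Scope classical_set_scope.
Local Open Scope ring_scope.

Section ReferenceFunction.
Variables (R : realType) (n : nat) (phi : 'rV[R]_n -> \bar R).
Hypothesis phi_ref : reference_function phi.

(** Real upper bounds [a] and [b] stand in for the values of [phi], which may be infinite, so that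
    later estimates take place in [R]. *)
Lemma ref_convex (a b : R) (x y : 'rV[R]_n) (t : R) :
  0 <= t <= 1 -> (phi x <= a%:E)%E -> (phi y <= b%:E)%E ->
  (phi (t *: x + (1 - t) *: y)%R <= (t * a + (1 - t) * b)%:E)%E.
Proof.
move=> /andP[t0 t1] xa yb.
(* Strong convexity covers only [0 < t < 1], so the endpoints are treated apart. *)
have [->|tN0] := eqVneq t 0; first by rewrite !(scale0r, add0r, subr0, scale1r, mul0r, mul1r).
have [->|tN1] := eqVneq t 1; first by rewrite !(scale0r, addr0, subrr, scale1r, mul0r, mul1r).
have t01 : 0 < t < 1 by rewrite !lt_def tN0 t0 eq_sym tN1.
have [mu mu0 /(_ x y t t01) h] := ref_strongly_convex phi_ref.
apply: (le_trans h).
rewrite (_ : (t * a + (1 - t) * b)%:E =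
  (t%:E * a%:E + (1 - t)%:E * b%:E + 0)%E); last by rewrite adde0.
apply: leeD.
  by apply: leeD; apply: lee_wpmul2l => //; rewrite lee_fin // subr_ge0.
rewrite -EFinN lee_fin oppr_le0.
apply: mulr_ge0; last exact: sqr_ge0.
by rewrite !mulr_ge0 ?subr_ge0 ?invr_ge0 ?(ltW mu0).
Qed.

(** The origin, where [phi] vanishes, is the midpoint of [x] and [- x], where [phi] takes equal
    values. *)
Lemma ref_ge0 (x : 'rV[R]_n) : (0 <= phi x)%E.
Proof.
case E : (phi x) => [r| |] //; last by move: (ref_proper phi_ref x); rewrite E.
have h : 0 <= (2^-1 : R) <= 1 by apply/andP; split; lra.
have xr : (phi x <= r%:E)%E by rewrite E.
have Nxr : (phi (- x)%R <= r%:E)%E by rewrite (ref_even phi_ref) E.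
have := ref_convex h xr Nxr.
have -> : 2^-1 *: x + (1 - 2^-1) *: - x = 0.
  by rewrite scalerN -scalerBl (_ : _ - _ = 0) ?scale0r //; lra.
by rewrite (ref0 phi_ref) !lee_fin; lra.
Qed.

Lemma ref_momentum_gap (a b alpha beta : R) (g m : 'rV[R]_n) :
  0 <= alpha <= 1 -> 0 <= beta <= 1 / 2 ->
  (phi g <= a%:E)%E -> (phi m <= b%:E)%E ->
  (phi (g - alpha *: (beta *: m + (1 - beta) *: g))%R
    <= ((1 - alpha) * a + alpha * beta * (a + b))%:E)%E.
Proof.
move=> alpha01 /andP[beta0 beta1] ga mb.
have h : 0 <= (2^-1 : R) <= 1 by apply/andP; split; lra.
have b01 : 0 <= 2 * beta <= 1 by apply/andP; split; lra.
have p0 : (phi 0%R <= 0%:E)%E by rewrite (ref0 phi_ref).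
have Nmb : (phi (- m)%R <= b%:E)%E by rewrite (ref_even phi_ref).
(* [beta *: (g - m)] combines the midpoint of [g] and [- m] with the origin, with weights [2 * beta]
   and [1 - 2 * beta]; hence the bound [beta <= 1 / 2]. *)
have mid := ref_convex b01 (ref_convex h ga Nmb) p0.
have := ref_convex alpha01 mid ga.
rewrite (_ : alpha *: _ + _ =
  g - alpha *: (beta *: m + (1 - beta) *: g)); last first.
  by apply/rowP => i; rewrite !mxE; field.
by congr (_ <= _)%E; congr _%:E; field.
Qed.

(* In [\bar R], [+oo - +oo = -oo], so anisotropic smoothness already forces the
   subtracted term to be finite. *)
Lemma anisotropic_step (f : 'rV[R]_n -> R) (L : R) (x d : 'rV[R]_n) :
  0 < L -> anisotropically_smooth phi L f ->
  let g := egrad (conjugate phi) (grad f x) in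
  phi g \is a fin_num /\
  forall b : R, (phi (g - d)%R <= b%:E)%E ->
    f (x - L^-1 *: d) <= f x + L^-1 * (b - fine (phi g)).
Proof.
move=> L0 fs g.
have LN0 : L != 0 by rewrite gt_eqF.
(* Moving from [x] by [- L^-1 *: z] makes the rescaled arguments of [phi] exactly [g - z] and
   [g]. *)
have step z : ((f (x - L^-1 *: z)%R)%:E <=
    (f x)%:E + (L^-1)%:E * phi (g - z)%R - (L^-1)%:E * phi g)%E.
  have := fs (x - L^-1 *: z) x; rewrite /episcale -/g invrK.
  rewrite (_ : L *: (_ - _) = g - z); last first.
    by apply/rowP => i; rewrite !mxE; field.
  rewrite (_ : L *: (_ - _) = g) //.
  by apply/rowP => i; rewrite !mxE; field.
have gfin : phi g \is a fin_num.
  case E : (phi g) => [r| |] //; last by move: (ref_proper phi_ref g); rewrite E.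
  by have := step 0; rewrite E gt0_muley ?lte_fin ?invr_gt0 // addeNy leeNy_eq.
split=> // b gb; have := step d.
rewrite -lee_fin; move=> /le_trans; apply.
rewrite -{1}(fineK gfin) -EFinM mulrBr addrA !(EFinB, EFinD).
by apply: leeB => //; apply: leeD => //; rewrite [leRHS]EFinM;
  apply: lee_wpmul2l => //; rewrite lee_fin invr_ge0 ltW.
Qed.

Lemma lyapunov_decrease (f : 'rV[R]_n -> R) (L alpha beta b : R)
    (x m : 'rV[R]_n) :
  0 < L -> 0 < alpha <= 1 -> 0 <= beta < 1 / 2 ->
  anisotropically_smooth phi L f -> (phi m <= b%:E)%E ->
  let g := egrad (conjugate phi) (grad f x) in
  let m' := beta *: m + (1 - beta) *: g in
  exists2 b' : R, (phi m' <= b'%:E)%E &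
    f (x - (alpha / L) *: m') + alpha / L * (beta / (1 - beta)) * b'
      + alpha / L * (1 - 2 * beta) * fine (phi g)
    <= f x + alpha / L * (beta / (1 - beta)) * b.
Proof.
move=> L0 /andP[alpha0 alpha1] /andP[beta0 beta1] fs mb g m'.
have [gfin step] := anisotropic_step x (alpha *: m') L0 fs.
rewrite -/g in gfin step.
have ga : (phi g <= (fine (phi g))%:E)%E by rewrite fineK.
have beta01 : 0 <= beta <= 1 by apply/andP; split; lra.
exists (beta * b + (1 - beta) * fine (phi g)).
  exact: ref_convex beta01 mb ga.
have alpha01 : 0 <= alpha <= 1 by rewrite (ltW alpha0).
have betah : 0 <= beta <= 1 / 2 by rewrite beta0 (ltW beta1).
have := step _ (ref_momentum_gap alpha01 betah ga mb).
rewrite scalerA (mulrC L^-1) => descent.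
rewrite -lerBrDr -lerBrDr; apply: (le_trans descent).
(* Equality holds: the weight [w = beta / (1 - beta)] solves [beta + w * beta = w], which balances
   the terms in [b]. *)
rewrite le_eqVlt; apply/orP; left; apply/eqP; field.
by apply/andP; split; rewrite gt_eqF //; lra.
Qed.

End ReferenceFunction.

(** If every term exceeded [c / K.+1%:R], the sum would exceed [c]. *)
Lemma bigmin_le_mean (R : realType) (K : nat) (u : nat -> \bar R) (c : R) :
  (forall k, u k \is a fin_num) -> \sum_(k < K.+1) fine (u k) <= c ->
  (\big[Order.min/+oo]_(k < K.+1) u k <= (c / K.+1%:R)%:E)%E.
Proof.
move=> ufin uc; rewrite leNgt; apply/negP => /bigmin_gtP[_ lt_u].
move: uc; apply/negP; rewrite -ltNge.
have -> : c = \sum_(k < K.+1) (c / K.+1%:R).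
  by rewrite sumr_const card_ord -[RHS]mulr_natr divfK // pnatr_eq0.
apply: ltr_sum => [|k _]; first by apply/hasP; exists ord0; rewrite ?mem_index_enum.
by rewrite -lte_fin fineK // lt_u.
Qed.

Theorem theorem2p2 (R : realType) (n : nat) (phi : 'rV[R]_n -> \bar R)
    (f : 'rV[R]_n -> R) (L alpha beta gamma : R) (x0 : 'rV[R]_n)
    (x m : nat -> 'rV[R]_n)
    (phi_ref : reference_function phi)
    (f_C1 : C1 f)
    (L_gt0 : 0 < L)
    (f_smooth : anisotropically_smooth phi L f)
    (f_lb : has_lbound (range f))
    (beta_bounds : 0 <= beta < 1 / 2)
    (alpha_bounds : 0 < alpha <= 1)
    (gammaE : gamma = alpha / L)
    (x_init : x 0%N = x0)
    (m_rec : forall k : nat,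
       m k = beta *: (if k is j.+1 then m j else 0)
             + (1 - beta) *: egrad (conjugate phi) (grad f (x k)))
    (x_rec : forall k : nat, x k.+1 = x k - gamma *: m k) :
  forall K : nat,
    (\big[Order.min/+oo]_(k < K.+1) phi (egrad (conjugate phi) (grad f (x k)))
     <= (L * (f x0 - inf (range f))
         / (alpha * K.+1%:R * (1 - 2 * beta)))%R%:E)%E.
Proof.
move=> K; pose g k := egrad (conjugate phi) (grad f (x k)).
(* The momentum paired with [x N] is the previous one, which is [0] for [N = 0]; there [b = 0]
   serves. *)
have lyapunov N : exists2 b : R,
    (phi (if N is j.+1 then m j else 0%R) <= b%:E)%E &
    f (x N) + alpha / L * (beta / (1 - beta)) * b
      + alpha / L * (1 - 2 * beta) * \sum_(k < N) fine (phi (g k)) <= f x0.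
  elim: N => [|N [b mb le_b]].
    exists 0; first by rewrite (ref0 phi_ref).
    by rewrite big_ord0 !mulr0 !addr0 x_init.
  have [b' mb' le_b'] :=
    lyapunov_decrease phi_ref (x N) L_gt0 alpha_bounds beta_bounds f_smooth mb.
  exists b'; first by rewrite m_rec.
  rewrite x_rec gammaE m_rec big_ord_recr /= mulrDr; move: le_b'; rewrite -/(g N).
  by move: le_b; lra.
have [alpha0 beta1 beta0] : [/\ 0 < alpha, beta < 1 / 2 & 0 <= beta].
  by case/andP: alpha_bounds; case/andP: beta_bounds.
have [b mb le_b] := lyapunov K.+1.
have b0 : 0 <= b by rewrite -lee_fin (le_trans (ref_ge0 phi_ref _) mb).
have inf_le : inf (range f) <= f (x K.+1) by apply: ge_inf => //; exists (x K.+1).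
have c0 : 0 < alpha / L * (1 - 2 * beta).
  by rewrite !mulr_gt0 ?invr_gt0 //; lra.
have sum_le : \sum_(k < K.+1) fine (phi (g k)) <=
    (f x0 - inf (range f)) / (alpha / L * (1 - 2 * beta)).
  rewrite ler_pdivlMr // mulrC.
  have : 0 <= alpha / L * (beta / (1 - beta)) * b.
    by rewrite !mulr_ge0 ?invr_ge0 ?(ltW alpha0) ?(ltW L_gt0) //; lra.
  by move: le_b inf_le; lra.
have gfin k : phi (g k) \is a fin_num.
  exact: (anisotropic_step phi_ref (x k) 0 L_gt0 f_smooth).1.
have := bigmin_le_mean gfin sum_le.
congr (_ <= _)%E; congr _%:E; field.
by rewrite !gt_eqF ?ltr0n //; lra.
Qed.
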